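(* Assume that $\lambda\in C^1(\mathbb R)$ is nonincreasing, nonnegative and vanishes on $[L,+\infty[$ for some $L>0$. Let the initial condition $f^{\mathrm{in}}\ge 0$ satisfy $$f^{\mathrm{in}}(x,p)\le\lambda\Big(\chi\big(x,p-\tfrac{m\omega_c}{2}\theta(0)\,{}^\perp x\big)+e\phi(0,x)\Big),\quad (x,p)\in\mathbb R^3\times\mathbb R^3,$$ where $$\chi(x,q)=\frac1{2m}\Big|q+\frac{m\omega_c}{2}\langle\theta\rangle\,{}^\perp x\Big|^2+\frac{m\omega_c^2}{4}\big(\langle\theta^2\rangle-\langle\theta\rangle^2\big)\frac{|{}^\perp x|^2}{2}.$$ If the electric potential $\phi\in C^1(\mathbb R_+\times\mathbb R^3)$ satisfies $$\lim_{|{}^\perp x|\to+\infty}\Big\{e\phi(t,x)-\int_0^t\sup_{y\in\mathbb R^3}\{e\,\partial_t\phi(s,y)\}\,ds+\frac{m\omega_c^2}{4}\big(\langle\theta^2\rangle-\langle\theta\rangle^2\big)\frac{|{}^\perp x|^2}{2}\Big\}=+\infty$$ uniformly with respect to $t\in\mathbb R_+$, $x_3\in\mathbb R$, then there is a constant $R>0$ such that for any $t\in\mathbb R_+$, $s\in\mathbb R$ the solution $f^0=f^0(t,s,x,p)$ of the problem $$\partial_t f^0+\Big(\frac pm-\frac{\omega_c}{2}(\theta(s)-\langle\theta\rangle)\,{}^\perp x\Big)\cdot\nabla_x f^0+\Big(eE(t,x)+\frac{\omega_c}{2}(\theta(s)+\langle\theta\rangle)\,{}^\perp p+\frac{m\omega_c^2}{4}(\langle\theta^2\rangle-\theta^2(s))\,{}^{\perp\perp}x\Big)\cdot\nabla_p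 f^0=0,$$ $$f^0(0,s,x,p)=f^{\mathrm{in}}\Big(x,\,p-\frac{m\omega_c}{2}(\theta(s)-\theta(0))\,{}^\perp x\Big),$$ with $E=-\nabla_x\phi$, verifies $$\mathrm{supp}\,f^0(t,s,\cdot,\cdot)\subset\{(x,p):|{}^\perp x|\le R\}.$$
   Context: Constants: $m>0$ (mass), $e$ (charge, a real number), $B>0$, $\omega_c=eB/m$. The profile $\theta:\mathbb R\to\mathbb R$ is of class $C^1$ and $T$-periodic ($T>0$); $\langle\theta\rangle=\frac1T\int_0^T\theta(s)\,ds$, $\langle\theta^2\rangle=\frac1T\int_0^T\theta^2(s)\,ds$. For $x\in\mathbb R^3$, ${}^\perp x=(x_2,-x_1,0)$ and ${}^{\perp\perp}x={}^\perp({}^\perp x)=(-x_1,-x_2,0)$. The variable $s$ is a parameter in the equation for $f^0$. The solution has the form $f^0(t,s,x,p)=g^0(t,x,p-\frac{m\omega_c}{2}\theta(s)\,{}^\perp x)$, where $g^0=g^0(t,x,q)$ is the solution of $$\partial_t g^0+\Big(\frac qm+\frac{\omega_c}{2}\langle\theta\rangle\,{}^\perp x\Big)\cdot\nabla_x g^0+\Big(eE(t,x)+\frac{\omega_c}{2}\langle\theta\rangle\,{}^\perp q+\frac{m\omega_c^2}{4}\langle\theta^2\rangle\,{}^{\perp\perp}x\Big)\cdot\nabla_q g^0=0,\quad g^0(0,x,q)=f^{\mathrm{in}}\Big(x,q+\frac{m\omega_c}{2}\theta(0)\,{}^\perp x\Big).$$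
   Formalization: It is additionally assumed that every point (t,x,p) is the endpoint of a characteristic of the equation defined on all of [0,t]; for φ merely C¹ characteristics may enter from infinity in finite time, and then ''the solution'' is not determined by the initial condition. *)

(* Defs.v *)
From HB Require Import structures.
From mathcomp Require Import all_boot all_order all_algebra.
From mathcomp Require Import all_classical all_reals all_analysis.
Import Order.TTheory GRing.Theory Num.Theory.
Import numFieldNormedType.Exports.

Set Implicit Arguments.
Unset Strict Implicit.
Unset Printing Implicit Defensive.

Local Open Scope classical_set_scope.
Local Open Scope ring_scope.

Notation vec3 R := 'rV[R]_3.

Definition dot {R : realType} (u v : vec3 R) : R := \sum_(i < 3) u 0 i * v 0 i.

(* The library norm of 'rV[R]_3 is the sup norm, not the Euclidean one. *)
Definition enorm {R : realType} (u : vec3 R) : R := Num.sqrt (dot u u).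

Definition perp {R : realType} (x : vec3 R) : vec3 R :=
  \row_(j < 3) [:: x 0 1; - x 0 0; 0]`_j.

Definition grad {R : realType} (u : vec3 R -> R) (x : vec3 R) : vec3 R :=
  \row_(i < 3) 'D_(delta_mx 0 i) u x.

Definition C1 {R : realType} (f : R -> R) : Prop :=
  (forall t, derivable f t 1) /\ continuous (derive1 f).

Definition mean {R : realType} (T : R) (f : R -> R) : R :=
  T^-1 * (\int[lebesgue_measure]_(s in `[0, T]) f s)%R.

Section half_space.
Context {R : realType}.
Implicit Types (u : R -> vec3 R -> R) (t : R) (x : vec3 R).

(* Only times t + h >= 0 are used: the derivative is two-sided for t > 0 and
   is the right derivative at t = 0. *)
Definition dtime_quotient u t x (h : R) : R := h^-1 * (u (t + h) x - u t x).

Definition dtime_nbhs t := within [set h : R | 0 <= t + h] (0 : R)^'.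

Definition dtime u t x : R := lim (dtime_quotient u t x @ dtime_nbhs t).

(* C^1 on [0, +oo[ x R^3: u and all its first-order partial derivatives exist
   and are jointly continuous up to and including t = 0. *)
Definition C1_half_space u : Prop :=
  let D := [set z : R * vec3 R | 0 <= z.1] in
  [/\ forall t x, 0 <= t -> cvg (dtime_quotient u t x @ dtime_nbhs t),
      forall t x (i : 'I_3), 0 <= t -> derivable (u t) x (delta_mx 0 i),
      {within D, continuous (fun z => u z.1 z.2)},
      {within D, continuous (fun z => dtime u z.1 z.2)} &
      {within D, continuous (fun z => grad (u z.1) z.2)}].

End half_space.

Section transport.
Context {R : realType}.
Variables a b : R -> vec3 R -> vec3 R -> vec3 R.

Record characteristic (t : R) (X P : R -> vec3 R) : Prop := {
  characteristic_continuousX : {within `[0, t], continuous X};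
  characteristic_continuousP : {within `[0, t], continuous P};
  characteristic_deriveX : forall r, 0 < r < t ->
    is_derive r 1 X (a r (X r) (P r));
  characteristic_deriveP : forall r, 0 < r < t ->
    is_derive r 1 P (b r (X r) (P r)) }.

(* What makes f(t, ., .) determined by f(0, ., .): without it characteristics
   may come from infinity in finite time when the field is merely continuous.
   Uniqueness of characteristics is not required. *)
Definition characteristics_reach_initial_time : Prop :=
  forall (t : R) (x p : vec3 R), 0 <= t ->
  exists X P : R -> vec3 R,
    [/\ characteristic t X P, X t = x & P t = p].

(* Every f of class C^1 on [0, +oo[ x R^3 x R^3 solving the equation pointwise
   qualifies; less regularity is demanded at t = 0. *)
Definition classical_solution (f : R -> vec3 R -> vec3 R -> R) : Prop :=
  let F (z : R * (vec3 R * vec3 R)) := f z.1 z.2.1 z.2.2 in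
  [/\ {within [set z : R * (vec3 R * vec3 R) | 0 <= z.1], continuous F},
      forall z : R * (vec3 R * vec3 R), 0 < z.1 -> differentiable F z &
      forall t x p, 0 < t ->
        derive1 (fun r => f r x p) t
        + dot (a t x p) (grad (fun y => f t y p) x)
        + dot (b t x p) (grad (fun q => f t x q) p) = 0].

(* No regularity of f is required here: this is what the equation means for
   initial data that are not differentiable. *)
Definition mild_solution (f : R -> vec3 R -> vec3 R -> R) : Prop :=
  forall t X P, 0 <= t -> characteristic t X P ->
  forall r, 0 <= r <= t -> f r (X r) (P r) = f 0 (X 0) (P 0).

(* Solution of d_t f + a . grad_x f + b . grad_p f = 0 on [0, +oo[ with
   f(0, ., .) = g. *)
Definition transport_solution (g : vec3 R -> vec3 R -> R)
    (f : R -> vec3 R -> vec3 R -> R) : Prop :=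
  (forall x p, f 0 x p = g x p) /\ (classical_solution f \/ mild_solution f).

End transport.

Section model.
Context {R : realType}.
Variables (m e B T : R) (theta : R -> R) (phi : R -> vec3 R -> R).

Definition omega_c : R := e * B / m.

Let th1 := mean T theta.
Let th2 := mean T (fun s => theta s ^+ 2).

Definition chi (x q : vec3 R) : R :=
  (2 * m)^-1 * enorm (q + (m * omega_c / 2 * th1) *: perp x) ^+ 2
  + m * omega_c ^+ 2 / 4 * (th2 - th1 ^+ 2) * (enorm (perp x) ^+ 2 / 2).

Definition Efield (t : R) (x : vec3 R) : vec3 R := - grad (phi t) x.

Definition velocity_field (s t : R) (x p : vec3 R) : vec3 R :=
  m^-1 *: p - (omega_c / 2 * (theta s - th1)) *: perp x.

Definition force_field (s t : R) (x p : vec3 R) : vec3 R :=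
  e *: Efield t x + (omega_c / 2 * (theta s + th1)) *: perp p
  + (m * omega_c ^+ 2 / 4 * (th2 - theta s ^+ 2)) *: perp (perp x).

Definition initial_datum (fin : vec3 R -> vec3 R -> R) (s : R)
    (x p : vec3 R) : R :=
  fin x (p - (m * omega_c / 2 * (theta s - theta 0)) *: perp x).

(* For phi of class C^1 the supremum is a lower semicontinuous function of s,
   bounded below on [0, t], so the integral is well defined in ]-oo, +oo]. *)
Definition sup_power_integral (t : R) : \bar R :=
  (\int[lebesgue_measure]_(s in `[0%R, t])
     ereal_sup (range (fun y : vec3 R => (e * dtime phi s y)%:E)))%E.

Definition confining_quantity (t : R) (x : vec3 R) : \bar R :=
  ((e * phi t x)%:E - sup_power_integral t
   + (m * omega_c ^+ 2 / 4 * (th2 - th1 ^+ 2)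
      * (enorm (perp x) ^+ 2 / 2))%:E)%E.

End model.

(* Main.v *)
(* Along a characteristic (X, P) of the transport equation at parameter s, the
   energy H(r) = chi(X, P - m omega_c theta(s)/2 perp X) + e phi(r, X) satisfies
   H' = e (d_t phi)(r, X), because the momentum in chi, shifted to
   u = P - m omega_c (theta(s) - <theta>)/2 perp X, equals m X' and all the
   magnetic terms cancel in its derivative.  Hence H(t) is at most
   H(0) + int_0^t sup_y e d_t phi(r, y) dr, so the confining quantity at
   (t, X(t)) is at most H(0).  Since f is constant along characteristics,
   f(t, x, p) != 0 forces lambda(H(0)) > 0, that is H(0) < L, and confinement
   bounds |perp x|. *)

Require Import Defs.
From HB Require Import structures.
From mathcomp Require Import all_boot all_order all_algebra.
From mathcomp Require Import all_classical all_reals all_analysis.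
From mathcomp Require Import ring lra.
Import Order.TTheory GRing.Theory Num.Theory.
Import numFieldNormedType.Exports.

Local Open Scope classical_set_scope.
Local Open Scope ring_scope.

Set Implicit Arguments.
Unset Strict Implicit.

(** * Comparison of integrals *)

(* No measurability is needed because the integral of a nonnegative function is
   a supremum over the simple functions below it. *)
Lemma le_integral_nomeas d (T : measurableType d) (R : realType)
    (mu : {measure set T -> \bar R}) (D : set T) (f g : T -> \bar R) :
  (forall x, D x -> f x <= g x)%E ->
  (\int[mu]_(x in D) f x <= \int[mu]_(x in D) g x)%E.
Proof.
(* Positive and negative parts are compared separately: [f <= g] increases the former and decreases
   the latter. *)
move=> fg; rewrite integralE [leRHS]integralE.
have nonneg_le (h k : T -> \bar R) : (forall x, 0 <= h x)%E ->
    (forall x, 0 <= k x)%E -> (forall x, D x -> h x <= k x)%E ->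
    (\int[mu]_(x in D) h x <= \int[mu]_(x in D) k x)%E.
  move=> h0 k0 hk; rewrite !ge0_integralE//; apply: ereal_sup_le => _ [u uh <-].
  exists u => //= x; apply: (le_trans (uh x)).
  by rewrite /patch; case: ifPn => // /set_mem; exact: hk.
have {}fg : {in D, forall x, (f x <= g x)%E} by move=> x /set_mem; exact: fg.
apply: leeB; apply: nonneg_le => // x /mem_set Dx.
  exact: funepos_le fg x Dx.
exact: funeneg_le fg x Dx.
Qed.

(** * Chain rule from continuous partial derivatives *)

(* By the mean value theorem along v: this gives the chain rule for functions
   with continuous partial derivatives without proving them differentiable. *)
Lemma cvg_directional_increment (R : realType) (V : normedModType R)
    (g : V -> R) (v y0 : V) (y : R -> V) (c : R -> R) (c' : R) :
  y h @[h --> 0^'] --> y0 -> h^-1 * c h @[h --> 0^'] --> c' ->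
  (\forall z \near y0, derivable g z v) ->
  {for y0, continuous (fun z => 'D_v g z)} ->
  h^-1 * (g (y h + c h *: v) - g (y h)) @[h --> 0^'] --> c' * 'D_v g y0.
Proof.
move=> cy cc dg cg.
have c0 : c h @[h --> 0^'] --> (0 : R).
  have : h * (h^-1 * c h) @[h --> 0^'] --> 0 * c'.
    by apply: cvgM => //; apply: cvg_within.
  rewrite mul0r; apply: cvg_trans; apply: near_eq_cvg; near=> h.
  rewrite mulrA divff ?mul1r//; near: h; exact: nbhs_dnbhs_neq.
(* [xi h] is the mean value point on the line through [y h] along [v]. It must be chosen for every
   [h], so the increment formula is conditional on derivability along the segment, and 0 is the
   default value where that fails. *)
have [xi xiP] : {xi : R -> R & forall h, `|xi h| <= `|c h| /\
   ((forall tau : R, `|tau| <= `|c h| -> derivable g (y h + tau *: v) v) ->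
    g (y h + c h *: v) - g (y h) = c h * 'D_v g (y h + xi h *: v))}.
  apply: (@choice _ _ (fun h xi => `|xi| <= `|c h| /\
   ((forall tau : R, `|tau| <= `|c h| -> derivable g (y h + tau *: v) v) ->
    g (y h + c h *: v) - g (y h) = c h * 'D_v g (y h + xi *: v)))) => h.
  have [seg|nseg] := pselect (forall tau : R, `|tau| <= `|c h| ->
     derivable g (y h + tau *: v) v); last first.
    by exists 0; rewrite normr0; split.
  pose w tau := g (y h + tau *: v).
  have dw (tau : R) : `|tau| <= `|c h| ->
      is_derive tau (1 : R) w ('D_v g (y h + tau *: v)).
    move=> /seg; rewrite /derivable => dgt.
    have E : (fun k => k^-1 *: ((w \o shift tau) (k *: (1 : R)) - w tau)) =
        (fun k => k^-1 *: ((g \o shift (y h + tau *: v)) (k *: v)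
                           - g (y h + tau *: v))).
      apply/funext => k; rewrite /w /= scalerDl.
      by rewrite [k *: (1 : R)]mulr1 addrCA.
    by split; rewrite /derivable /derive E.
  (* Rescaling the segment to [0, 1] makes the mean value theorem independent of the sign of
     [c h]. *)
  have dwc (t : R) : 0 <= t <= 1 -> is_derive t (1 : R) (w \o ( *%R^~ (c h)))
       ('D_v g (y h + (t * c h) *: v) * c h).
    move=> /andP[t0 t1]; apply: is_derive1_comp.
      by apply: dw; rewrite normrM ler_piMl// ger0_norm.
    have := @is_deriveM _ _ id (cst (c h)) t 1 _ _ _ _.
    by move=> /(_ 1 0 _ _); rewrite scaler0 add0r [_ *: _]mulr1; apply.
  have [||t t01] := @MVT_segment R (w \o ( *%R^~ (c h)))
    (fun t => 'D_v g (y h + (t * c h) *: v) * c h) 0 1 ler01.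
  - move=> t; rewrite in_itv/= => /andP[t0 t1]; apply: dwc.
    by rewrite !ltW.
  - apply: derivable_within_continuous => t; rewrite in_itv/= => t01.
    by have [] := dwc t t01.
  - rewrite /w /= mul0r mul1r scale0r addr0 subr0 mulr1 => E.
    exists (t * c h); split; last by rewrite E mulrC.
    move: t01; rewrite in_itv/= => /andP[t0 t1].
    by rewrite normrM ler_piMl// ger0_norm.
have xi0 : xi h *: v @[h --> 0^'] --> (0 : V).
  rewrite -(scale0r v); apply: cvgZr_tmp.
  apply/norm_cvg0P; apply: (@squeeze_cvgr _ _ _ _ (cst 0) (fun h => `|c h|)).
  - by near=> h; rewrite normr_ge0 (xiP h).1.
  - exact: cvg_cst.
  - by have := @cvg_norm _ _ _ _ _ _ _ c0; rewrite normr0; apply.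
have lim :
    (h^-1 * c h) * 'D_v g (y h + xi h *: v) @[h --> 0^'] --> c' * 'D_v g y0.
  apply: cvgM => //.
  have yx : y h + xi h *: v @[h --> 0^'] --> y0.
    by rewrite -[y0]addr0; exact: cvgD.
  exact: (cvg_comp _ _ yx cg).
apply: cvg_trans lim; apply: near_eq_cvg.
have /nbhs_ballP[e /= e0 be] := dg.
near=> h; rewrite -mulrA -(xiP h).2; first by [].
move=> tau tauc.
apply: be; rewrite -ball_normE /= opprD addrA.
rewrite (le_lt_trans (ler_normB _ _))// normrZ (splitr e) ltrD//.
  near: h; apply: (cvgr_dist_lt _ _ cy); exact: divr_gt0.
(* The other half of the radius goes to [tau *: v]; the added 1 keeps the divisor positive when [v]
   is zero. *)
apply: (@le_lt_trans _ _ (`|c h| * (`|v| + 1))).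
  by rewrite ler_pM// lerDl.
rewrite -ltr_pdivlMr ?ltr_wpDl//.
by near: h; apply: (cvgr0_norm_lt _ c0); rewrite !divr_gt0// ltr_wpDl.
Unshelve. all: by end_near. Qed.

(** The increment is telescoped one direction at a time. Each intermediate base point moves with [h]
    but tends to [z0], which is why the one-direction lemma allows a moving base point [y h]. *)
Lemma cvg_increment_partials (R : realType) (V : normedModType R) (g : V -> R)
    (z0 : V) (v : nat -> V) (c : nat -> R -> R) (c' : nat -> R) (n : nat) :
  (forall i, (i < n)%N -> h^-1 * c i h @[h --> 0^'] --> c' i) ->
  (forall i, (i < n)%N -> \forall z \near z0, derivable g z (v i)) ->
  (forall i, (i < n)%N -> {for z0, continuous (fun z => 'D_(v i) g z)}) ->
  h^-1 * (g (z0 + \sum_(i < n) c i h *: v i) - g z0) @[h --> 0^'] -->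
  \sum_(i < n) c' i * 'D_(v i) g z0.
Proof.
elim: n => [|n IH] cc dg cg.
  under eq_fun do rewrite big_ord0 addr0 subrr mulr0.
  by rewrite big_ord0; exact: cvg_cst.
rewrite big_ord_recr/=.
have cz : z0 + \sum_(i < n) c i h *: v i @[h --> 0^'] --> z0.
  rewrite -[X in _ --> X]addr0; apply: cvgD; first exact: cvg_cst.
  have ci0 i : (i < n)%N -> c i h *: v i @[h --> 0^'] --> (0 : V).
    move=> ni; rewrite -(scale0r (v i)); apply: cvgZr_tmp.
    have : h * (h^-1 * c i h) @[h --> 0^'] --> 0 * c' i.
      apply: cvgM; first exact: cvg_within.
      by apply: cc; rewrite ltnS ltnW.
    rewrite mul0r; apply: cvg_trans; apply: near_eq_cvg; near=> h.
    rewrite mulrA divff ?mul1r//; near: h; exact: nbhs_dnbhs_neq.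
  have : forall k, (k <= n)%N ->
      \sum_(i < k) c i h *: v i @[h --> 0^'] --> (0 : V).
    elim=> [|k IHk] kn.
      by under eq_fun do rewrite big_ord0; exact: cvg_cst.
    under eq_fun do rewrite big_ord_recr/=.
    by have := cvgD (IHk (ltnW kn)) (ci0 k kn); rewrite addr0; apply.
  by apply.
have step := cvg_directional_increment cz (cc n (ltnSn n)) (dg n (ltnSn n))
  (cg n (ltnSn n)).
have rest : h^-1 * (g (z0 + \sum_(i < n) c i h *: v i) - g z0) @[h --> 0^'] -->
    \sum_(i < n) c' i * 'D_(v i) g z0.
  by apply: IH => i ?; [apply: cc|apply: dg|apply: cg]; rewrite ltnS ltnW.
apply: cvg_trans (cvgD rest step); apply: near_eq_cvg; near=> h => /=.
rewrite big_ord_recr/= -mulrDr [z0 + (_ + _)]addrA; congr (_ * _).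
by rewrite fctE addrC subrKA.
Unshelve. all: by end_near. Qed.

Lemma is_derive_coord (R : realType) (X : R -> vec3 R) (X' : vec3 R) (r : R) i :
  is_derive r (1 : R) X X' -> is_derive r (1 : R) (fun s => X s 0 i) (X' 0 i).
Proof.
move=> [dX <-]; rewrite derive_mx// mxE.
exact/derivableP/(derivable_mxP X r 1).1.
Qed.

(** * Differentiation of [phi] along a curve at positive times *)

Section half_space.
Context {R : realType}.
Implicit Types (phi : R -> vec3 R -> R) (t : R) (x : vec3 R).

(** For [t > 0] the constraint [0 <= t + h] holds for all small [h], so the one-sided restriction
    disappears. *)
Lemma dtime_nbhsE t : 0 < t -> dtime_nbhs t = (0 : R)^'.
Proof.
move=> t0; rewrite /dtime_nbhs; apply/seteqP; split=> A /= hA; last first.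
  by apply: filterS hA => h Ah _; exact: Ah.
have nn : \forall h \near (0 : R)^', 0 <= t + h.
  near=> h; rewrite -lerBlDl sub0r; apply: lerNnormlW.
  by near: h; exact: dnbhs0_le.
by apply: (@filterS2 _ (0 : R)^' _ _ _ _ _ hA nn) => h; apply.
Unshelve. all: by end_near. Qed.

Lemma derivable_time phi t x : 0 < t ->
  cvg (dtime_quotient phi t x @ dtime_nbhs t) ->
  derivable (fun z : R * vec3 R => phi z.1 z.2) (t, x) (1, 0).
Proof.
move=> t0; rewrite (dtime_nbhsE t0) /derivable.
by under [X in _ -> cvg (X @ _)]eq_fun do
  rewrite /= scaler0 add0r [_ *: (1 : R)]mulr1 (addrC _ t).
Qed.

Lemma derive_time phi t x : 0 < t ->
  'D_((1, 0) : R * vec3 R) (fun z => phi z.1 z.2) (t, x) = dtime phi t x.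
Proof.
move=> t0; rewrite /dtime (dtime_nbhsE t0) /derive.
by under eq_fun do rewrite /= scaler0 add0r [_ *: (1 : R)]mulr1 (addrC _ t).
Qed.

Lemma derivable_space phi t x v : derivable (phi t) x v ->
  derivable (fun z : R * vec3 R => phi z.1 z.2) (t, x) (0, v).
Proof.
rewrite /derivable.
by under [X in _ -> cvg (X @ _)]eq_fun do rewrite /= scaler0 add0r.
Qed.

Lemma derive_space phi t x v :
  'D_((0, v) : R * vec3 R) (fun z => phi z.1 z.2) (t, x) = 'D_v (phi t) x.
Proof. by rewrite /derive; under eq_fun do rewrite /= scaler0 add0r. Qed.

Lemma near_half_space (t : R) x : 0 < t ->
  \forall z \near ((t, x) : R * vec3 R), 0 < z.1.
Proof. by move=> t0; exact: (cvg_fst (lt_nbhsr t0)). Qed.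

Lemma within_half_space_continuous (U : topologicalType)
    (F : R * vec3 R -> U) t x : 0 < t ->
  {within [set z : R * vec3 R | 0 <= z.1], continuous F} ->
  {for (t, x), continuous F}.
Proof.
move=> t0 /subspace_continuousP /(_ (t, x) (ltW t0)).
rewrite within_interior//.
by apply: filterS (near_half_space x t0) => z /ltW.
Qed.

(** The displacement of the graph of [X] is split into one time direction and three coordinate
    directions, to which the telescoped increment applies. *)
Lemma is_derive_along phi (r : R) (X : R -> vec3 R) (X' : vec3 R) :
  C1_half_space phi -> 0 < r -> is_derive r (1 : R) X X' ->
  is_derive r (1 : R) (fun s => phi s (X s))
    (dtime phi r (X r) + dot X' (grad (phi r) (X r))).
Proof.
move=> [phit phix _ cphit cphix] r0 dX.
pose g (z : R * vec3 R) := phi z.1 z.2.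
pose z0 := (r, X r).
(* Direction 0 is time and direction [j.+1] is the space coordinate [j]; [c] holds the increments
   and [c'] their rates. *)
pose v (i : nat) : R * vec3 R :=
  if i is j.+1 then (0, delta_mx 0 (inord j)) else (1, 0).
pose c (i : nat) (h : R) :=
  if i is j.+1 then X (r + h) 0 (inord j) - X r 0 (inord j) else h.
pose c' (i : nat) : R := if i is j.+1 then X' 0 (inord j) else 1.
have cvgX i : h^-1 * (X (r + h) 0 i - X r 0 i) @[h --> 0^'] --> X' 0 i.
  have [] := is_derive_coord i dX; rewrite /derivable /derive => + <-.
  have -> // : (fun h => h^-1 * (X (r + h) 0 i - X r 0 i)) =
     (fun h => h^-1 *: (((fun s => X s 0 i) \o shift r) (h *: (1 : R))
                        - X r 0 i)).
  by apply/funext => h; rewrite /= [_ *: (1 : R)]mulr1 (addrC h).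
have lim := @cvg_increment_partials R _ g z0 v c c' 4.
have {lim} : h^-1 * (g (z0 + \sum_(i < 4) c i h *: v i) - g z0) @[h --> 0^']
    --> \sum_(i < 4) c' i * 'D_(v i) g z0.
  apply: lim.
  - case=> [_|j jn] /=; last exact: cvgX.
    have one : (fun=> 1 : R) h @[h --> (0 : R)^'] --> (1 : R) by exact: cvg_cst.
    apply: cvg_trans one; apply: near_eq_cvg.
    by near=> h; rewrite mulVf//; near: h; exact: nbhs_dnbhs_neq.
  - move=> i _; apply: filterS (near_half_space (X r) r0) => -[s y] /= s0.
    case: i => [|j].
      by apply: derivable_time => //; exact/phit/ltW.
    by apply: derivable_space; exact/phix/ltW.
  - case=> [_|j _].
      have : {for z0, continuous (fun z : R * vec3 R => dtime phi z.1 z.2)}.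
        exact: within_half_space_continuous.
      rewrite /prop_for /continuous_at /= -(derive_time phi (X r) r0).
      apply: cvg_trans; apply: near_eq_cvg.
      apply: filterS (near_half_space (X r) r0) => -[s y] /= s0.
      by rewrite derive_time.
    have cg : {for z0, continuous (fun z : R * vec3 R => grad (phi z.1) z.2)}.
      exact: within_half_space_continuous.
    have := cvg_comp _ _ cg (@coord_continuous R 1 3 0 (inord j) _).
    rewrite /prop_for /continuous_at /= mxE -derive_space.
    apply: cvg_trans; apply: near_eq_cvg.
    by apply: filterE => -[s y]; rewrite derive_space /= mxE.
have -> : (fun h => h^-1 * (g (z0 + \sum_(i < 4) c i h *: v i) - g z0)) =
    (fun h => h^-1 *: (((fun s => phi s (X s)) \o shift r) (h *: (1 : R))
                       - phi r (X r))).
  apply/funext => h; rewrite /= [_ *: (1 : R)]mulr1 (addrC h) /g.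
  suff -> : z0 + \sum_(i < 4) c i h *: v i = (r + h, X (r + h)) by [].
  (* The four increments add up exactly to the displacement of the graph between times [r] and
     [r + h]. *)
  have -> : \sum_(i < 4) c i h *: v i = (h, X (r + h) - X r).
    rewrite big_ord_recl (eq_bigr (fun i : 'I_3 =>
        (0, (X (r + h) - X r) 0 i *: delta_mx 0 i) : R * vec3 R)); last first.
      move=> i _; rewrite /= inord_val !mxE.
      by congr pair => /=; rewrite scaler0.
    rewrite (_ : \sum_(i < 3) _ = (0, X (r + h) - X r)); last first.
      rewrite [in RHS](row_sum_delta (X (r + h) - X r)).
      by elim/big_rec2: _ => // i y1 y2 _ ->; congr pair; rewrite /= add0r.
    by congr pair; rewrite /= ?scaler0 ?add0r// addr0 [_ *: _]mulr1.
  by congr pair; rewrite /= ?subrKC.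
have -> : \sum_(i < 4) c' i * 'D_(v i) g z0 =
   dtime phi r (X r) + dot X' (grad (phi r) (X r)).
  rewrite big_ord_recl /= mul1r derive_time//; congr (_ + _).
  rewrite /dot; apply: eq_bigr => i _.
  by rewrite /= derive_space mxE inord_val.
move=> lim; split; last exact: (cvg_lim _ lim).
by apply/cvg_ex; eexists; exact: lim.
Unshelve. all: by end_near. Qed.

End half_space.

(** * Continuity and derivatives of compositions with curves *)

(** Over [0, t] the graph stays in the closed half space, so continuity within that half space
    carries over even at time 0, where the graph meets the boundary. *)
Lemma within_continuous_graph (R : realType) (V U : topologicalType)
    (F : R * V -> U) (X : R -> V) (t : R) :
  {within [set z : R * V | 0 <= z.1], continuous F} ->
  {within `[0, t], continuous X} ->
  {within `[0, t], continuous (fun s => F (s, X s))}.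
Proof.
move=> /subspace_continuousP cF /subspace_continuousP cX.
apply/subspace_continuousP => s st W /= WF.
have s0 : 0 <= s by move: st; rewrite /= in_itv/= => /andP[].
have FW := cF (s, X s) s0 W WF.
have cG : (u, X u) @[u --> within [set` `[0, t]] (nbhs s)] --> (s, X s).
  have idc : u @[u --> within [set` `[0, t]] (nbhs s)] --> s.
    exact: cvg_within.
  exact: (cvg_pair idc (cX s st)).
have H : \forall u \near nbhs s, `[0, t]%classic u -> 0 <= u -> W (F (u, X u)).
  exact: cG _ FW.
suff : \forall u \near nbhs s, `[0, t]%classic u -> W (F (u, X u)) by [].
apply: filterS H => u + ut; apply => //.
by move: ut; rewrite /= in_itv/= => /andP[].
Qed.

Lemma is_derive_pair (R : realType) (U V : normedModType R) (X : R -> U)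
    (P : R -> V) (r : R) (X' : U) (P' : V) :
  is_derive r (1 : R) X X' -> is_derive r (1 : R) P P' ->
  is_derive r (1 : R) (fun s => (X s, P s)) (X', P').
Proof.
move=> [/derivable1_diffP dX <-] [/derivable1_diffP dP <-].
split; first by apply/derivable1_diffP; exact: differentiable_pair.
rewrite (deriveE _ (differentiable_pair dX dP)).
have -> := congr1 (fun h => h (1 : R)) (diff_pair dX dP).
by rewrite (deriveE _ dX) (deriveE _ dP).
Qed.

Lemma is_derive_comp_diff (R : realType) (V : normedModType R) (F : V -> R)
    (g : R -> V) (r : R) (g' : V) :
  differentiable F (g r) -> is_derive r (1 : R) g g' ->
  is_derive r (1 : R) (F \o g) ('d F (g r) g').
Proof.
move=> dF [/derivable1_diffP dg <-].
split; first by apply/derivable1_diffP; exact: differentiable_comp.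
rewrite (deriveE _ (differentiable_comp dg dF)).
have -> := congr1 (fun h => h (1 : R)) (diff_comp dg dF).
by rewrite /= (deriveE _ dg).
Qed.

(** * Solutions are constant along characteristics *)

Section classical.
Context {R : realType}.
Variables a b : R -> vec3 R -> vec3 R -> vec3 R.
Variable f : R -> vec3 R -> vec3 R -> R.

Let F (z : R * (vec3 R * vec3 R)) := f z.1 z.2.1 z.2.2.

Let diff_time t x p : differentiable F (t, (x, p)) ->
  'd F (t, (x, p)) (1, (0, 0)) = derive1 (fun r => f r x p) t.
Proof.
move=> /deriveE <-; rewrite derive1E /derive.
by under eq_fun do rewrite /F /= !scaler0 !add0r.
Qed.

Let diff_position t x p v : differentiable F (t, (x, p)) ->
  'd F (t, (x, p)) (0, (v, 0)) = 'D_v (fun y => f t y p) x.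
Proof.
move=> /deriveE <-; rewrite /derive.
by under eq_fun do rewrite /F /= !scaler0 !add0r.
Qed.

Let diff_momentum t x p v : differentiable F (t, (x, p)) ->
  'd F (t, (x, p)) (0, (0, v)) = 'D_v (fun q => f t x q) p.
Proof.
move=> /deriveE <-; rewrite /derive.
by under eq_fun do rewrite /F /= !scaler0 !add0r.
Qed.

(** With [u] and [v] the values of the fields [a] and [b], the right side is the left side of the
    transport equation, which thus becomes a single directional derivative of [F]. *)
Lemma diff_decomposition t x p (u v : vec3 R) : differentiable F (t, (x, p)) ->
  'd F (t, (x, p)) (1, (u, v)) =
  derive1 (fun r => f r x p) t + dot u (grad (fun y => f t y p) x)
  + dot v (grad (fun q => f t x q) p).
Proof.
move=> dF.
have -> : (1, (u, v)) = (1, (0, 0)) + (0, (u, 0)) + (0, (0, v))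
    :> R * (vec3 R * vec3 R).
  by congr (_, (_, _)); rewrite /= ?addr0 ?add0r.
rewrite !linearD/= diff_time//; congr (_ + _ + _).
- have -> : (0, (u, 0)) = \sum_(i < 3) u 0 i *: (0, (delta_mx 0 i, 0))
      :> R * (vec3 R * vec3 R).
    rewrite [in LHS](row_sum_delta u).
    elim/big_rec2: _ => // i y1 y2 _ <-.
    by congr (_, (_, _)); rewrite /= ?scaler0 ?add0r.
  rewrite linear_sum; apply: eq_bigr => i _.
  by rewrite linearZ/= diff_position// mxE.
- have -> : (0, (0, v)) = \sum_(i < 3) v 0 i *: (0, (0, delta_mx 0 i))
      :> R * (vec3 R * vec3 R).
    rewrite [in LHS](row_sum_delta v).
    elim/big_rec2: _ => // i y1 y2 _ <-.
    by congr (_, (_, _)); rewrite /= ?scaler0 ?add0r.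
  rewrite linear_sum; apply: eq_bigr => i _.
  by rewrite linearZ/= diff_momentum// mxE.
Qed.

(** The derivative of [f] along the characteristic vanishes on the open interval by the equation;
    continuity up to both endpoints lets the mean value theorem conclude. *)
Lemma classical_solution_characteristic t X P : 0 <= t ->
  classical_solution a b f -> characteristic a b t X P ->
  f t (X t) (P t) = f 0 (X 0) (P 0).
Proof.
move=> t0 [cF dF eqF] [cX cP dX dP].
pose G r := f r (X r) (P r).
have cG : {within `[0, t], continuous G}.
  apply: (@within_continuous_graph _ _ _ F (fun r => (X r, P r))) => //.
  move/subspace_continuousP : cX => cX; move/subspace_continuousP : cP => cP.
  by apply/subspace_continuousP => r rt; exact: (cvg_pair (cX r rt) (cP r rt)).
have dG r : r \in `]0, t[ -> is_derive r 1 G 0.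
  rewrite in_itv/= => rt; have r0 : 0 < r by case/andP: rt.
  have dF3 : differentiable F (r, (X r, P r)) by exact: dF.
  have dg := is_derive_pair (is_derive_id r 1)
    (is_derive_pair (dX r rt) (dP r rt)).
  have := is_derive_comp_diff (g := fun s => (s, (X s, P s))) dF3 dg.
  by rewrite diff_decomposition// eqF.
have [c _] := MVT_segment t0 dG cG.
by rewrite mul0r => /eqP; rewrite subr_eq0 => /eqP.
Qed.

Lemma transport_solution_characteristic g t X P : 0 <= t ->
  transport_solution a b g f -> characteristic a b t X P ->
  f t (X t) (P t) = g (X 0) (P 0).
Proof.
move=> t0 [fg [cf|mf]] XP; rewrite -fg.
  exact: classical_solution_characteristic XP.
by apply: mf XP _ _ => //; rewrite t0 lexx.
Qed.

End classical.

(** * Euclidean norms in coordinates *)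

Lemma dot_coord (R : realType) (u v : vec3 R) :
  dot u v = u 0 0 * v 0 0 + u 0 1 * v 0 1 + u 0 2 * v 0 2.
Proof.
rewrite /dot !big_ord_recl big_ord0 addr0 addrA.
by congr (_ + _ * _ + _ * _); congr (_ 0 _); apply: val_inj.
Qed.

Lemma enorm_sqr (R : realType) (u : vec3 R) :
  enorm u ^+ 2 = u 0 0 ^+ 2 + u 0 1 ^+ 2 + u 0 2 ^+ 2.
Proof.
by rewrite /enorm sqr_sqrtr dot_coord -?expr2// !addr_ge0// sqr_ge0.
Qed.

Lemma continuous_enorm_perp (R : realType) :
  continuous (fun z : vec3 R * vec3 R => enorm (perp z.1)).
Proof.
move=> z.
have ci i : {for z, continuous (fun z : vec3 R * vec3 R => z.1 0 i)}.
  exact: (continuous_comp cvg_fst (@coord_continuous R 1 3 0 i z.1)).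
have -> : (fun z : vec3 R * vec3 R => enorm (perp z.1)) =
    (fun z => Num.sqrt (z.1 0 1 * z.1 0 1 + z.1 0 0 * z.1 0 0)).
  apply/funext => y; rewrite /enorm dot_coord !mxE/=.
  by congr Num.sqrt; ring.
apply: (@continuous_comp _ _ _
  (fun z : vec3 R * vec3 R => z.1 0 1 * z.1 0 1 + z.1 0 0 * z.1 0 0)
  Num.sqrt); last exact: sqrt_continuous.
by apply: cvgD; apply: cvgM; exact: ci.
Qed.

(** * The energy and its derivative along characteristics *)

Section energy.
Context {R : realType}.
Variables (m e B T : R) (theta : R -> R) (phi : R -> vec3 R -> R).

Let om := omega_c m e B.
Let th1 := mean T theta.
Let th2 := mean T (fun s => theta s ^+ 2).
Let k (s : R) := m * om / 2 * (theta s - th1).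
Let d := m * om ^+ 2 / 4 * (th2 - th1 ^+ 2).

(** The shift by [theta s] and the shift by the mean inside [chi] combine into the coefficient
    [k s]. The first bracket is the squared Euclidean norm of [m] times the velocity field. *)
Lemma chi_coord (s : R) (x p : vec3 R) :
  chi m e B T theta x (p - (m * omega_c m e B / 2 * theta s) *: perp x) =
  (2 * m)^-1 * ((p 0 0 - k s * x 0 1) ^+ 2 + (p 0 1 + k s * x 0 0) ^+ 2
                + p 0 2 ^+ 2)
  + d * ((x 0 0 ^+ 2 + x 0 1 ^+ 2) / 2).
Proof.
rewrite /chi !enorm_sqr !mxE /= -/th1 -/th2 -/om -/d /k.
by congr (_ * _ + _ * _); ring.
Qed.

Definition energy (s : R) (X P : R -> vec3 R) (r : R) : R :=
  chi m e B T theta (X r)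
    (P r - (m * omega_c m e B / 2 * theta s) *: perp (X r))
  + e * phi r (X r).

(** As [s] is frozen, [k s] is constant in [r]. Put u = m X' = P - k(s) perp X. Since k(s) omega_c
    (theta(s) + <theta>)/2 = m omega_c^2 (theta(s)^2 - <theta>^2)/4, the force gives u' = e E +
    omega_c <theta> perp u + d perp(perp X). In u.u'/m the gyroscopic term vanishes, the [d] term
    cancels the derivative of d |perp X|^2/2, and e E.X' cancels the spatial part of the derivative
    of e phi. *)
Lemma is_derive_energy (s r : R) (X P : R -> vec3 R) :
  m != 0 -> C1_half_space phi -> 0 < r ->
  is_derive r (1 : R) X (velocity_field m e B T theta s r (X r) (P r)) ->
  is_derive r (1 : R) P (force_field m e B T theta phi s r (X r) (P r)) ->
  is_derive r (1 : R) (energy s X P) (e * dtime phi r (X r)).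
Proof.
move=> m0 Cphi r0 dX dP.
have dphi := is_derive_along Cphi r0 dX.
have dx0 := is_derive_coord 0 dX; have dx1 := is_derive_coord 1 dX.
have dp0 := is_derive_coord 0 dP; have dp1 := is_derive_coord 1 dP.
have dp2 := is_derive_coord 2 dP.
have -> : energy s X P =
  (2 * m)^-1 \*: ((((fun r => P r 0 0) - k s \*: (fun r => X r 0 1)) ^+ 2
     + ((fun r => P r 0 1) + k s \*: (fun r => X r 0 0)) ^+ 2
     + (fun r => P r 0 2) ^+ 2) : R -> R)
  + (d / 2) \*: (((fun r => X r 0 0) ^+ 2 + (fun r => X r 0 1) ^+ 2) : R -> R)
  + e \*: ((fun r => phi r (X r)) : R -> R).
  apply/funext => u; rewrite /energy chi_coord !fctE /=.
  by rewrite /GRing.scale/=; ring.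
apply: is_derive_eq.
rewrite dot_coord /velocity_field /force_field /Efield !fctE !mxE /=.
rewrite /GRing.scale /= /k /d -/om -/th1 -/th2.
by field; rewrite m0.
Qed.

End energy.

(** * Integrated energy bound *)

Section energy_inequality.
Context {R : realType}.
Variables (m e B T : R) (theta : R -> R) (phi : R -> vec3 R -> R).
Hypotheses (m_gt0 : 0 < m) (phi_C1 : C1_half_space phi).

Local Notation velocity := (velocity_field m e B T theta).
Local Notation force := (force_field m e B T theta phi).
Local Notation energy := (energy m e B T theta phi).

Lemma within_continuous_coord (t : R) (X : R -> vec3 R) i :
  {within `[0, t], continuous X} ->
  {within `[0, t], continuous (fun r => X r 0 i)}.
Proof.
move=> /subspace_continuousP cX; apply/subspace_continuousP => r rt.
exact: (cvg_comp _ _ (cX r rt) (@coord_continuous R 1 3 0 i _)).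
Qed.

Lemma within_continuous_energy s t X P :
  characteristic (velocity s) (force s) t X P ->
  {within `[0, t], continuous (energy s X P)}.
Proof.
move=> [cX cP _ _].
have [_ _ cphi _ _] := phi_C1.
have := within_continuous_graph cphi cX.
move=> /subspace_continuousP cphiX.
have cXi i := (subspace_continuousP _ _).1 (@within_continuous_coord t X i cX).
have cPi i := (subspace_continuousP _ _).1 (@within_continuous_coord t P i cP).
apply/subspace_continuousP => r rt.
rewrite /from_subspace /energy chi_coord.
under eq_fun do rewrite /energy chi_coord.
apply: cvgD; last by apply: cvgM; [exact: cvg_cst|exact: cphiX].
apply: cvgD.
  apply: cvgM; first exact: cvg_cst.
  apply: cvgD; last by apply: cvgM; exact: cPi.
  apply: cvgD; apply: cvgM.
  1,2: apply: cvgB; [exact: cPi|apply: cvgM; [exact: cvg_cst|exact: cXi]].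
  1,2: apply: cvgD; [exact: cPi|apply: cvgM; [exact: cvg_cst|exact: cXi]].
apply: cvgM; first exact: cvg_cst.
apply: cvgM; last exact: cvg_cst.
by apply: cvgD; apply: cvgM; exact: cXi.
Qed.

Lemma energy_le s t X P : 0 <= t ->
  characteristic (velocity s) (force s) t X P ->
  ((energy s X P t)%:E <=
   (energy s X P 0)%:E + sup_power_integral e phi t)%E.
Proof.
move=> t0 XP; have cH := within_continuous_energy XP.
(* At [t = 0] the integral is over a point and vanishes; the fundamental theorem of calculus is used
   only on a nondegenerate interval. *)
move: t0; rewrite le_eqVlt => /predU1P[<-|t0].
  by rewrite /sup_power_integral set_itv1 integral_set1 adde0.
have [cX cP dX dP] := XP; have [_ _ _ cdt _] := phi_C1.
pose power r := e * dtime phi r (X r).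
have dH r : r \in `]0, t[ -> is_derive r (1 : R) (energy s X P) (power r).
  rewrite in_itv/= => rt; apply: is_derive_energy => //.
  - by rewrite gt_eqF.
  - by case/andP: rt.
  - exact: dX.
  - exact: dP.
have cpower : {within `[0, t], continuous power}.
  have /subspace_continuousP cdX := within_continuous_graph cdt cX.
  apply/subspace_continuousP => r rt; apply: cvgM; first exact: cvg_cst.
  exact: cdX.
have FTC : (\int[lebesgue_measure]_(r in `[0%R, t]) (power r)%:E =
    (energy s X P t)%:E - (energy s X P 0)%:E)%E.
  apply: continuous_FTC2 => //.
    have [_ cH0 cHt] := (continuous_within_itvP _ t0).1 cH.
    by split=> // r rt; case: (dH r rt).
  by move=> r rt; rewrite derive1E; case: (dH r rt).
(* The power at time [r] is one of the values, the one at y = X(r), over which the supremum is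
   taken. *)
rewrite addeC -leeBlDr// -FTC; apply: le_integral_nomeas => r _.
by apply: ereal_sup_ubound; exists (X r).
Qed.

Lemma confining_quantity_le_energy s t X P : 0 <= t ->
  characteristic (velocity s) (force s) t X P ->
  (confining_quantity m e B T theta phi t (X t) <= (energy s X P 0)%:E)%E.
Proof.
move=> t0 XP; have := energy_le t0 XP.
rewrite /confining_quantity /energy /chi.
set K := (2 * m)^-1 * _; set W := m * _ ^+ 2 / 4 * _ * _.
move: (sup_power_integral e phi t) => S.
have K0 : 0 <= K by rewrite mulr_ge0// ?sqr_ge0// invr_ge0 mulr_ge0// ltW.
(* If [S] is -oo, the energy bound contradicts finiteness of the energy; if [S] is +oo, the
   confining quantity is -oo. *)
case: S => [S| |] //=.
  rewrite -EFinB -!EFinD !lee_fin => h.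
  move: K0 h; lra.
by rewrite leNye.
Qed.

End energy_inequality.

(** * Confinement of the support *)

Unset Implicit Arguments.

Theorem theorem2p2 (R : realType) (m e B T : R) (theta : R -> R)
  (lambda : R -> R) (L : R) (fin : vec3 R -> vec3 R -> R)
  (phi : R -> vec3 R -> R)
  (m_gt0 : 0 < m) (B_gt0 : 0 < B) (T_gt0 : 0 < T)
  (theta_C1 : C1 theta) (theta_periodic : periodic theta T)
  (lambda_C1 : C1 lambda)
  (lambda_noninc : forall u v, u <= v -> lambda v <= lambda u)
  (lambda_ge0 : forall u, 0 <= lambda u)
  (L_gt0 : 0 < L) (lambda_eq0 : forall u, L <= u -> lambda u = 0)
  (fin_ge0 : forall x p, 0 <= fin x p)
  (fin_le : forall x p,
    fin x p <= lambda (chi m e B T theta x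
                         (p - (m * omega_c m e B / 2 * theta 0) *: perp x)
                       + e * phi 0 x))
  (phi_C1 : C1_half_space phi)
  (phi_confining : forall A : R, exists r : R, forall t x,
    0 <= t -> r <= enorm (perp x) ->
    (A%:E <= confining_quantity m e B T theta phi t x)%E)
  (well_posed : forall s, characteristics_reach_initial_time
    (velocity_field m e B T theta s) (force_field m e B T theta phi s)) :
  exists Rad : R, 0 < Rad /\
    forall f0 : R -> R -> vec3 R -> vec3 R -> R,
    (forall s, transport_solution
       (velocity_field m e B T theta s) (force_field m e B T theta phi s)
       (initial_datum m e B theta fin s) (fun t => f0 t s)) ->
    forall t s, 0 <= t ->
      closure [set z : vec3 R * vec3 R | f0 t s z.1 z.2 != 0]
        `<=` [set z | enorm (perp z.1) <= Rad].
Proof.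
(* The level [L], where [lambda] starts to vanish, fixes the radius before [f0], [t] and [s] are
   introduced; the maximum with 1 makes it positive. *)
have [r hr] := phi_confining L.
exists (Num.max r 1); split; first by rewrite lt_max ltr01 orbT.
move=> f0 sol t s t0.
have supp z : f0 t s z.1 z.2 != 0 -> enorm (perp z.1) <= Num.max r 1.
  case: z => x p /= fz; rewrite le_max; apply/orP; left.
  have [X [P [XP Xt Pt]]] := well_posed s t x p t0.
  rewrite leNgt; apply/negP => /ltW rx.
  have := transport_solution_characteristic t0 (sol s) XP.
  rewrite Xt Pt => f0E.
  (* If the initial energy were at least [L], then [lambda] and hence [fin] would vanish at the foot
     of the characteristic, and so would [f0] at (x, p). *)
  have Hlt : energy m e B T theta phi s X P 0 < L.
    rewrite ltNge; apply/negP => LH; move/eqP: fz; apply; rewrite f0E.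
    apply/eqP; rewrite eq_le fin_ge0 andbT.
    have : lambda (energy m e B T theta phi s X P 0) <= 0 by rewrite lambda_eq0.
    apply: le_trans; apply: (le_trans (fin_le _ _)); apply: lambda_noninc.
    rewrite /energy.
    (* The shift by [theta s - theta 0] in the initial datum and the shift by [theta 0] in the bound
       on [fin] add up to the shift by [theta s] in the energy. *)
    have <- : P 0 - (m * omega_c m e B / 2 * (theta s - theta 0)) *: perp (X 0)
        - (m * omega_c m e B / 2 * theta 0) *: perp (X 0) =
      P 0 - (m * omega_c m e B / 2 * theta s) *: perp (X 0); last exact: lexx.
    by rewrite -addrA -opprD -scalerDl; congr (_ - _ *: _); ring.
  (* Outside the radius, [L] is at most the confining quantity, hence at most the initial energy,
     which is below [L]. *)
  have := le_trans (hr _ _ t0 rx).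
  rewrite -Xt => /(_ _ (confining_quantity_le_energy m_gt0 phi_C1 t0 XP)).
  by rewrite lee_fin leNgt Hlt.
(* The pointwise bound passes to the closure because the cylinder is closed. *)
have : closed [set z : vec3 R * vec3 R | enorm (perp z.1) <= Num.max r 1].
  apply: (@preimage_closed _ _ (fun z : vec3 R * vec3 R => enorm (perp z.1))
    [set y | y <= Num.max r 1]); last exact: closed_le.
  by move=> z _; exact: continuous_enorm_perp.
by move=> /closure_id ->; apply: closureS => z; exact: supp.
Qed.
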